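(* Let $A\in\mathbb{Z}^{m\times n}$, $b\in\mathbb{Z}^m$, $\Delta$ the largest absolute value of an entry of $A$, $\mathcal{P}=\{x\in\mathbb{R}^n_{\ge0}: Ax=b\}$ and $\mathcal{P}_I=\operatorname{Conv}(\mathcal{P}\cap\mathbb{Z}^n)$. The number of vertices of $\mathcal{P}_I$ is at most $(n\cdot m\cdot\log(m\Delta))^{O(m\log(\sqrt{m}\Delta))}$.
   Context: All logarithms are base 2; the $O(\cdot)$ hides an absolute constant. A vertex of $\mathcal{P}_I$ is a point $v\in\mathcal{P}_I$ with $v\notin\operatorname{Conv}(\mathcal{P}_I\setminus\{v\})$.
   Formalization: The formal statement assumes mΔ > 1, i.e. log(mΔ) > 0: for Δ = 0 the logarithm is undefined, and for m = Δ = 1 the bound reads 0^0 and fails, e.g. A = (1 1), b = 1 has two vertices. *)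

(* Defs.v *)
From HB Require Import structures.
From mathcomp Require Export all_boot all_order all_algebra.
From mathcomp Require Export finmap.
From mathcomp Require Export mathcomp_extra boolp classical_sets functions.
From mathcomp Require Export cardinality reals exp.

Set Implicit Arguments.
Unset Strict Implicit.
Unset Printing Implicit Defensive.

Import Order.TTheory GRing.Theory Num.Theory.

Local Open Scope classical_set_scope.
Local Open Scope ring_scope.

Section IntegerHull.
Variable R : realType.

Definition conv (n : nat) (S : set 'cV[R]_n) : set 'cV[R]_n :=
  [set x : 'cV[R]_n | exists (k : nat) (w : 'I_k -> R) (p : 'I_k -> 'cV[R]_n),
    [/\ forall i, 0 <= w i, \sum_(i < k) w i = 1, forall i, S (p i)
      & x = \sum_(i < k) w i *: p i]].

Definition vertices (n : nat) (Q : set 'cV[R]_n) : set 'cV[R]_n :=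
  [set v | Q v /\ ~ conv (Q `\ v) v].

Definition polyhedron (m n : nat) (A : 'M[int]_(m, n)) (b : 'cV[int]_m) :
    set 'cV[R]_n :=
  [set x : 'cV[R]_n | (forall j, 0 <= x j 0) /\ map_mx intr A *m x = map_mx intr b].

Definition integer_points (n : nat) : set 'cV[R]_n :=
  [set x : 'cV[R]_n | exists z : 'cV[int]_n, x = map_mx intr z].

Definition integer_hull (m n : nat) (A : 'M[int]_(m, n)) (b : 'cV[int]_m) :
    set 'cV[R]_n :=
  conv (polyhedron A b `&` @integer_points n).

Definition log2 (x : R) : R := ln x / ln 2.

End IntegerHull.

Definition max_abs_entry (m n : nat) (A : 'M[int]_(m, n)) : nat :=
  (\max_(i < m) \max_(j < n) `|A i j|)%N.

(* Main.v *)
Require Import Defs.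
From mathcomp Require Import zify ring lra.
(** Call an integer point z >= 0 rigid if no nonzero integer g in ker A satisfies
    |g_j| <= z_j for all j.  Vertices of the integer hull are rigid, since
    otherwise z is the midpoint of z + g and z - g.

    Rigid points have small support: if the support has at least 5mt elements,
    where m Delta <= 2^t, two subsets of its columns have the same sum and the
    difference of their indicators is a forbidden g.

    Two rigid points y, z with A y = A z coincide as soon as each y_j, z_j lie in
    the same dyadic interval or both exceed a bound G = (2 n Delta + 1)^m.
    Indeed d = z - y contains a short kernel vector: with D = |d|_oo, the integer
    points floor(k d / D) for 0 <= k <= G stay so close to the line spanned by d
    that their images under A lie in a box with G points.  Two of these images
    agree, and the difference g of the corresponding points satisfies
    |g_j| <= min(|d_j|, G) <= y_j.

    Hence a vertex is determined by the list of pairs (support index, capped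
    dyadic scale), and there are at most (n (log G + 2))^(5mt) such lists. *)

Set Implicit Arguments.
Unset Strict Implicit.

Import Order.TTheory GRing.Theory Num.Theory.
Local Open Scope ring_scope.

(** * Pigeonhole and size estimates for integer vectors *)

Lemma int_box_pigeonhole (T : finType) (X : {set T}) (m N : nat)
    (f : T -> 'cV[int]_m) :
  (forall x i, x \in X -> `|f x i 0| <= N%:Z) ->
  ((2 * N).+1 ^ m < #|X|)%N ->
  exists x y, [/\ x \in X, y \in X, x != y & f x = f y].
Proof.
(* Shifting by [N] moves each coordinate into [0 .. 2 * N], where [inord] loses nothing. *)
move=> fN cX; pose h x : {ffun 'I_m -> 'I_(2 * N).+1} :=
  [ffun i => inord (absz (f x i 0 + N%:Z))].
have : ~~ [forall x in X, forall y in X, (h x == h y) ==> (x == y)].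
  apply/negP => /forall_inP hinj; move: cX; rewrite ltnNge => /negP; apply.
  rewrite -(card_in_imset (f := h) (D := mem X)).
    by rewrite (leq_trans (max_card _)) // card_ffun !card_ord.
  by move=> x y xX yX /eqP; move/hinj: xX => /forall_inP/(_ _ yX)/implyP E /E/eqP.
rewrite negb_forall_in => /exists_inP[x xX].
rewrite negb_forall_in => /exists_inP[y yX].
rewrite negb_imply => /andP[/eqP hxy xy]; exists x, y; split => //.
apply/colP => i; move/ffunP/(_ i): hxy; rewrite !ffunE => /(congr1 val) /=.
have := fN x i xX; have := fN y i yX => ? ?.
rewrite !inordK; lia.
Qed.

Lemma max_abs_entryP (m n : nat) (A : 'M[int]_(m, n)) i j :
  `|A i j| <= (max_abs_entry A)%:Z.
Proof.
have h : (absz (A i j) <= max_abs_entry A)%N.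
  apply: (leq_trans (@leq_bigmax _ (fun j => absz (A i j)) j)).
  exact: (@leq_bigmax _ (fun i => \max_(j < n) absz (A i j))%N i).
by lia.
Qed.

Lemma mulmx_abs_le (m n : nat) (A : 'M[int]_(m, n)) (J : {set 'I_n}) (x : 'cV[int]_n)
    (c : nat) i :
  (forall j, `|x j 0| <= c%:Z) -> (forall j, j \notin J -> x j 0 = 0) ->
  `|(A *m x) i 0| <= (#|J| * max_abs_entry A * c)%N%:Z.
Proof.
move=> xc xJ; rewrite mxE (bigID (mem J)) /= [X in _ + X]big1 ?addr0; last first.
  by move=> j /xJ ->; rewrite mulr0.
apply: (le_trans (ler_norm_sum _ _ _)).
apply: (le_trans (y := \sum_(j in J) (max_abs_entry A * c)%N%:Z)).
  apply: ler_sum => j _; rewrite normrM PoszM.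
  by apply: ler_pM => //; apply: max_abs_entryP.
by rewrite sumr_const -mulr_natl natz -PoszM mulnA.
Qed.

(** Since [c] is an integer, taking floors does not push two quotients at distance at most [c]
    further apart than [c]. *)
Lemma divz_dist_le (D c x y : int) :
  0 < D -> `|x - y| <= c * D -> `|(x %/ D)%Z - (y %/ D)%Z| <= c.
Proof.
move=> D0 h; have Dn : D != 0 by lia.
have := divz_eq x D; have := divz_eq y D.
have := ltz_mod x Dn; have := ltz_mod y Dn.
have := modz_ge0 x Dn; have := modz_ge0 y Dn.
move: (x %/ D)%Z (y %/ D)%Z (x %% D)%Z (y %% D)%Z => q q' r r'.
nia.
Qed.

(** * Short kernel vectors *)

Lemma short_kernel_vector (m n : nat) (A : 'M[int]_(m, n)) (d : 'cV[int]_n) :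
  A *m d = 0 -> d != 0 ->
  exists g : 'cV[int]_n, [/\ g != 0, A *m g = 0,
    forall j, `|g j 0| <= `|d j 0|
    & forall j, `|g j 0| <= ((2 * (n * max_abs_entry A)).+1 ^ m)%N%:Z].
Proof.
move=> Ad d0; set G := (_ ^ m)%N.
have [j1 dj1] : exists j, d j 0 != 0.
  apply/existsP; apply: contraNT d0; rewrite negb_exists => /forallP h.
  by apply/eqP/colP => j; rewrite mxE; have := h j; rewrite negbK => /eqP.
have [j0 _ dmax] := @arg_maxnP _ j1 predT (fun j => absz (d j 0)) isT.
pose D : int := `|d j0 0|.
have dD j : `|d j 0| <= D by have := dmax j isT; lia.
have D0 : 0 < D by have := dD j1; lia.
have [DG|GD] := leP D G%:Z.
  by exists d; split => // j; apply: le_trans DG.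
pose p (k : nat) : 'cV[int]_n := \col_j divz (k%:Z * d j 0) D.
have Ap (k : 'I_G.+1) i : `|(A *m p k) i 0| <= (n * max_abs_entry A)%N%:Z.
  (* As [A d = 0], the vector [A (p k)] equals [- A r / D], where the remainders satisfy
     [0 <= r_j < D]. *)
  pose r : 'cV[int]_n := \col_j modz (k%:Z * d j 0) D.
  have Er : D *: p k = k%:Z *: d - r.
    by apply/colP => j; rewrite !mxE {2}(divz_eq (k%:Z * d j 0) D) addrK mulrC.
  have : `|(A *m r) i 0| <= (#|[set: 'I_n]| * max_abs_entry A * absz D)%N%:Z.
    apply: mulmx_abs_le => [j|j]; last by rewrite inE.
    rewrite mxE; have Dn : D != 0 by lia.
    have := ltz_mod (k%:Z * d j 0) Dn; have := modz_ge0 (k%:Z * d j 0) Dn; lia.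
  have -> : A *m r = - (D *: (A *m p k)).
    by rewrite scalemxAr Er mulmxBr -scalemxAr Ad scaler0 sub0r opprK.
  rewrite cardsT card_ord !mxE normrN normrM PoszM.
  have -> : Posz (absz D) = D by lia.
  by rewrite gtr0_norm // mulrC ler_pM2r.
have [||k [k' [_ _ kk' Akk']]] :=
    @int_box_pigeonhole _ [set: 'I_G.+1] m
      (n * max_abs_entry A)%N (fun k => A *m p k).
- by move=> k i _; apply: Ap.
- by rewrite cardsT card_ord.
have kk'D : `|k%:Z - k'%:Z| <= G%:Z.
  by have := ltn_ord k; have := ltn_ord k'; lia.
exists (p k - p k'); split.
(* At [j0] the entry of [d] is [D] or [- D], so [p k] is [k] or [- k] there and distinct [k] give
   distinct points. *)
- apply: contra kk' => /eqP/colP/(_ j0); rewrite !mxE => /eqP.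
  have dj0 : d j0 0 = D \/ d j0 0 = - D by rewrite /D; lia.
  have Dn : D != 0 by lia.
  case: dj0 => ->; last rewrite !(mulrN _%:Z) -!(mulNr _%:Z).
    by rewrite !mulzK // => h; apply/eqP/val_inj => /=; lia.
  by rewrite !mulzK // => h; apply/eqP/val_inj => /=; lia.
- by rewrite mulmxBr Akk' subrr.
(* Before flooring, the entries differ by [|k - k'| |d_j| / D]: at most [|d_j|] by
   [|k - k'| <= G < D], and at most [G] by [|d_j| <= D]. *)
- move=> j; rewrite !mxE; apply: divz_dist_le => //.
  rewrite -mulrBl normrM mulrC; apply: ler_wpM2l => //.
  by apply: le_trans kk'D (ltW GD).
- move=> j; rewrite !mxE; apply: divz_dist_le => //.
  by rewrite -mulrBl normrM; apply: ler_pM.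
Qed.

(** * Rigid points and their supports *)

Definition kernel_rigid (m n : nat) (A : 'M[int]_(m, n)) (z : 'cV[int]_n) :=
  (forall j, 0 <= z j 0) /\
  forall g : 'cV[int]_n, A *m g = 0 -> (forall j, `|g j 0| <= z j 0) -> g = 0.

Definition supp (n : nat) (z : 'cV[int]_n) : {set 'I_n} :=
  [set j | z j 0 != 0].

Lemma linear_lt_expn t : (0 < t)%N -> (10 * t + 1 < 16 ^ t)%N.
Proof. by elim: t => [|[|t] IH] // _; rewrite expnS; have := IH isT; lia. Qed.

Lemma card_supp_lt (m n : nat) (A : 'M[int]_(m, n)) (z : 'cV[int]_n) (t : nat) :
  (0 < m)%N -> (0 < t)%N -> (m * max_abs_entry A <= 2 ^ t)%N ->
  kernel_rigid A z -> (#|supp z| < 5 * m * t)%N.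
Proof.
move=> m0 t0 mD [z0 zr]; rewrite ltnNge; apply/negP => hq.
set q := (5 * m * t)%N in hq.
(* Keeping exactly [q] columns makes the number of subsets and the box size both functions of
   [q]. *)
pose J := [set j in take q (enum (supp z))].
have cJ : #|J| = q.
  rewrite cardsE; have /card_uniqP -> : uniq (take q (enum (supp z))).
    exact/take_uniq/enum_uniq.
  by rewrite size_takel // -cardE.
have JS : J \subset supp z.
  by apply/fintype.subsetP => j; rewrite inE => /mem_take; rewrite mem_enum.
pose ind (X : {set 'I_n}) : 'cV[int]_n := \col_j (j \in X)%:R.
have [||X [Y [XJ YJ XY AXY]]] := @int_box_pigeonhole _ (powerset J) m
    (q * max_abs_entry A)%N (fun X => A *m ind X).
- move=> X i; rewrite inE => XJ; rewrite -cJ -[(_ * _)%N]muln1.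
  apply: mulmx_abs_le => j; first by rewrite mxE; case: (_ \in _).
  by move=> jJ; rewrite mxE (contraNF (fintype.subsetP XJ j) jJ).
- have -> : #|powerset J| = ((2 ^ (5 * t)) ^ m)%N.
    by rewrite card_powerset cJ /q -expnM; congr (_ ^ _)%N; lia.
  rewrite ltn_exp2r //.
  (* The box side [2 * q * Delta + 1] is at most [(10 * t + 1) * 2 ^ t], hence below
     [16 ^ t * 2 ^ t = 2 ^ (5 * t)]. *)
  have h1 := linear_lt_expn t0.
  have -> : (2 ^ (5 * t) = 2 ^ t * 16 ^ t)%N by rewrite !(expnM 2) -expnMn.
  have : (0 < 2 ^ t)%N by rewrite expn_gt0.
  rewrite /q; nia.
have : ind X - ind Y = 0.
  apply: zr; first by rewrite mulmxBr AXY subrr.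
  (* The indicators differ by at most 1 on the support, where [z_j >= 1], and both vanish off it. *)
  move=> j; rewrite !mxE; have := z0 j.
  move: XJ YJ; rewrite !inE => XJ YJ.
  have [jS|jS] := boolP (j \in supp z).
    by move: jS; rewrite inE; case: (_ \in _); case: (_ \in _); lia.
  have jJ := contraNN (fintype.subsetP JS j) jS.
  by rewrite (contraNF (fintype.subsetP XJ j) jJ) (contraNF (fintype.subsetP YJ j) jJ).
move/eqP; apply/negP; apply: contra XY => /eqP/colP E.
apply/eqP/setP => j; have := E j; rewrite !mxE.
by case: (_ \in _); case: (_ \in _).
Qed.

(** * Dyadic scales and codes *)

(* Scale 0 encodes the value 0; scale K.+1 collects every x >= 2 ^ K. *)
Definition dyadic (K x : nat) : 'I_K.+2 :=
  if x == 0%N then ord0 else inord (minn K (trunc_log 2 x)).+1.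

(** The first alternative gives [|y - x| <= x] for natural numbers; in the second, [x] exceeds any
    short kernel entry once [G <= 2 ^ K]. *)
Lemma dyadic_eq (K x y : nat) :
  dyadic K x = dyadic K y -> (y <= 2 * x)%N \/ (2 ^ K <= x)%N.
Proof.
rewrite /dyadic => /(congr1 val) /=.
have [->|x0] := eqVneq x 0%N; have [->|y0] := eqVneq y 0%N; rewrite /= ?inordK;
  try lia.
move=> [E]; have x0' : (0 < x)%N by lia.
have /andP[x1 _] := trunc_log_bounds (p := 2) isT x0'.
have [Kx|xK] := leqP K (trunc_log 2 x).
  by right; apply: leq_trans x1; rewrite leq_exp2l.
left; have E' : trunc_log 2 x = trunc_log 2 y by lia.
by have := @trunc_log_ltn 2 y isT; rewrite -E' expnS; lia.
Qed.

Lemma dyadic_rigid_inj (m n K : nat) (A : 'M[int]_(m, n)) (y z : 'cV[int]_n) :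
  ((2 * (n * max_abs_entry A)).+1 ^ m <= 2 ^ K)%N ->
  kernel_rigid A y -> kernel_rigid A z -> A *m y = A *m z ->
  (forall j, dyadic K (absz (y j 0)) = dyadic K (absz (z j 0))) -> y = z.
Proof.
move=> GK [y0 yr] [z0 _] Ayz E; apply/eqP; rewrite eq_sym -subr_eq0.
apply/negPn/negP => d0.
have Ad : A *m (z - y) = 0 by rewrite mulmxBr Ayz subrr.
have [g [g0 Ag gd gG]] := short_kernel_vector Ad d0.
move/eqP: g0; apply; apply: yr => // j.
have := gd j; have := gG j; rewrite !mxE.
have := y0 j; have := z0 j; have := dyadic_eq (E j); move: GK.
move: (_ ^ m)%N (2 ^ K)%N (g j 0) (y j 0) (z j 0) => G H gj yj zj.
lia.
Qed.

(** Supports smaller than [s] are padded with the index [i0] and the actual scale of [z] there, so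
    all codes have the same length. *)
Definition dyadic_code (n K s : nat) (i0 : 'I_n) (z : 'cV[int]_n) :
    {ffun 'I_s -> 'I_n * 'I_K.+2} :=
  [ffun k : 'I_s => let i := nth i0 (enum (supp z)) k in
     (i, dyadic K (absz (z i 0)))].

(** Every pair of a code, padding included, holds an index and the true scale at that index. The
    pair of [y] naming [j] is also a pair of [z]. *)
Lemma dyadic_code_supp (n K s : nat) (i0 : 'I_n) (y z : 'cV[int]_n) j :
  (#|supp y| <= s)%N -> dyadic_code K s i0 y = dyadic_code K s i0 z ->
  j \in supp y -> dyadic K (absz (y j 0)) = dyadic K (absz (z j 0)).
Proof.
move=> ys /ffunP E jy.
have js : (index j (enum (supp y)) < s)%N.
  by apply: leq_trans ys; rewrite cardE index_mem mem_enum.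
have := E (Ordinal js); rewrite !ffunE /= nth_index ?mem_enum //.
by case=> <-.
Qed.

Lemma dyadic_code_inj (n K s : nat) (i0 : 'I_n) (y z : 'cV[int]_n) :
  (#|supp y| <= s)%N -> (#|supp z| <= s)%N ->
  dyadic_code K s i0 y = dyadic_code K s i0 z ->
  forall j, dyadic K (absz (y j 0)) = dyadic K (absz (z j 0)).
Proof.
move=> ys zs E j.
have [jy|] := boolP (j \in supp y); first exact: dyadic_code_supp E jy.
have [jz _|] := boolP (j \in supp z).
  by symmetry; apply: dyadic_code_supp (esym E) jz.
by rewrite !inE !negbK => /eqP-> /eqP->.
Qed.

(** * Vertices of the integer hull *)

Local Open Scope classical_set_scope.

Lemma finite_set_inj (T : choiceType) (U : finType) (V : set T) (f : T -> U) :
  {in V &, injective f} ->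
  finite_set V /\ (#|` fset_set V| <= #|U|)%N.
Proof.
move=> finj; have VI : (V #<= `I_#|U|)%card.
  apply/pcard_leP/injfunPex; exists (fun x => nat_of_ord (enum_rank (f x))).
    by move=> x _ /=; apply: ltn_ord.
  by move=> x y xV yV /= /val_inj/enum_rank_inj/finj; apply.
by split; [apply/finite_set_leP; exists #|U| | apply: geq_card_fset_set].
Qed.

Section Vertices.
Variable R : realType.
Variables (m n : nat) (A : 'M[int]_(m, n)) (b : 'cV[int]_m).

Local Notation toR := (map_mx (intr : int -> R)).

Lemma conv_sub (S : set 'cV[R]_n) : S `<=` conv S.
Proof.
move=> x Sx; exists 1%N, (fun=> 1), (fun=> x); split => //.
  by rewrite big_ord1.
by rewrite big_ord1 scale1r.
Qed.

Lemma conv_midpoint (S : set 'cV[R]_n) (x g : 'cV[R]_n) :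
  S (x + g) -> S (x - g) -> conv S x.
Proof.
move=> Sp Sm; exists 2%N, (fun=> 2^-1), (fun i => if i == 0 then x + g else x - g).
split => [i||i|].
- by rewrite invr_ge0.
- by rewrite !big_ord_recl big_ord0 addr0; field.
- by case: (i == 0).
- rewrite !big_ord_recl big_ord0 addr0 /= -scalerDr addrACA subrr addr0.
  by rewrite -mulr2n -scaler_nat scalerA mulVf ?scale1r // pnatr_eq0.
Qed.

(** If [v] were outside [S], the points of [S] that represent it would all differ from [v]. *)
Lemma vertices_conv (S : set 'cV[R]_n) : vertices (conv S) `<=` S.
Proof.
move=> v [[k [w [p [w0 w1 Sp vE]]]] nv]; apply: contrapT => Sv.
apply: nv; exists k, w, p; split => // i; split; first exact: conv_sub.
by move=> /= E; apply: Sv; rewrite -E.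
Qed.

Lemma toR_inj (k : nat) : injective (toR : 'cV[int]_k -> 'cV[R]_k).
Proof.
by move=> x y /colP E; apply/colP => i; have := E i; rewrite !mxE => /intr_inj.
Qed.

Lemma integer_pointP (z : 'cV[int]_n) :
  (polyhedron A b `&` @integer_points R n) (toR z) <->
  (forall j, 0 <= z j 0) /\ A *m z = b.
Proof.
split=> [[[z0 Az] _]|[z0 Az]].
  split=> [j|]; first by have := z0 j; rewrite mxE ler0z.
  by apply: toR_inj; rewrite map_mxM.
split; last by exists z.
by split=> [j|]; [rewrite mxE ler0z | rewrite -map_mxM Az].
Qed.

Lemma vertices_rigid (v : 'cV[R]_n) : vertices (integer_hull A b) v ->
  exists z : 'cV[int]_n, [/\ v = toR z, A *m z = b & kernel_rigid A z].
Proof.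
move=> vV; have := vertices_conv vV => -[Pv [z vE]].
have [z0 Az] : (forall j, 0 <= z j 0) /\ A *m z = b.
  by apply/integer_pointP; rewrite -vE; split => //; exists z.
exists z; split => //; split => // g Ag gz; apply: contrapT => g0.
case: vV => _; apply; rewrite vE; apply: (@conv_midpoint _ _ (toR g)).
(* Both endpoints are feasible by [A g = 0] and [|g_j| <= z_j], and differ from [z] because [g] is
   nonzero. *)
all: rewrite -?map_mxD -?map_mxB; split.
- apply/conv_sub/integer_pointP; split=> [j|]; last by rewrite mulmxDr Ag addr0.
  by have := gz j; rewrite !mxE; move: (g j 0) (z j 0) => x y; lia.
- move=> /= /toR_inj E; apply: g0; apply: (addrI z); rewrite E addr0 //.
- apply/conv_sub/integer_pointP; split=> [j|]; last by rewrite mulmxBr Ag subr0.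
  by have := gz j; rewrite !mxE; move: (g j 0) (z j 0) => x y; lia.
- move=> /= /toR_inj E; apply: g0; apply: oppr_inj; apply: (addrI z).
  by rewrite E oppr0 addr0.
Qed.

(** Vertices are real vectors with integer entries, so [Num.floor] recovers the integer point to
    which [f] applies. *)
Lemma card_vertices_inj (U : finType) (f : 'cV[int]_n -> U) :
  (forall y z, kernel_rigid A y -> kernel_rigid A z -> A *m y = A *m z ->
     f y = f z -> y = z) ->
  finite_set (vertices (@integer_hull R m n A b)) /\
  (#|` fset_set (vertices (@integer_hull R m n A b))| <= #|U|)%N.
Proof.
move=> finj; apply: (@finite_set_inj _ _ _ (fun v => f (map_mx Num.floor v))).
have toRK (z : 'cV[int]_n) : map_mx Num.floor (toR z) = z.
  by apply/matrixP => i j; rewrite !mxE intrKfloor.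
move=> v w /set_mem/vertices_rigid[y [-> Ay yr]].
move=> /set_mem/vertices_rigid[z [-> Az zr]].
by rewrite !toRK => E; rewrite (finj y z) ?Ay.
Qed.

Lemma card_vertices_le (t : nat) :
  (0 < m)%N -> (0 < n)%N -> (0 < t)%N ->
  (m * max_abs_entry A <= 2 ^ t)%N ->
  finite_set (vertices (@integer_hull R m n A b)) /\
  (#|` fset_set (vertices (@integer_hull R m n A b))|
     <= (n * (m * (n + t + 2)).+2) ^ (5 * m * t))%N.
Proof.
move=> m0 n0 t0 mD.
(* This [K] gives [G <= 2 ^ K], since [2 * n * Delta + 1 <= 4 * 2 ^ n * 2 ^ t]. *)
set K := (m * (n + t + 2))%N; set s := (5 * m * t)%N.
have -> : ((n * K.+2) ^ s)%N = #|{ffun 'I_s -> 'I_n * 'I_K.+2}|.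
  by rewrite card_ffun card_prod !card_ord.
apply: (card_vertices_inj (f := dyadic_code K s (Ordinal n0))) => y z yr zr Ayz E.
apply: (dyadic_rigid_inj _ yr zr Ayz (K := K)); last first.
  by apply: dyadic_code_inj E; apply: ltnW; apply: card_supp_lt mD _.
rewrite /K (mulnC m) expnM leq_exp2r //.
rewrite !expnD.
have nN : (n <= 2 ^ n)%N by apply/ltnW/ltn_expl.
have DT : (max_abs_entry A <= 2 ^ t)%N by apply: leq_trans mD; rewrite leq_pmull.
have := leq_mul nN DT; have : (0 < 2 ^ n * 2 ^ t)%N by rewrite muln_gt0 !expn_gt0.
lia.
Qed.

End Vertices.

(** * The single-column case and the final estimate *)

(** A single nonzero column makes [A] injective, so even a constant code separates the rigid
    points. *)
Lemma card_vertices_le1 (R : realType) (m n : nat) (A : 'M[int]_(m, n))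
    (b : 'cV[int]_m) :
  (n <= 1)%N -> max_abs_entry A != 0%N ->
  finite_set (vertices (@integer_hull R m n A b)) /\
  (#|` fset_set (vertices (@integer_hull R m n A b))| <= 1)%N.
Proof.
move=> n1 A0; rewrite -[X in (_ <= X)%N]card_unit.
apply: (card_vertices_inj R b (f := fun=> tt)) => y z _ _ Ayz _.
apply/colP => j; apply/eqP; rewrite -subr_eq0; apply: contraTT A0 => d0.
rewrite negbK -leqn0; apply/bigmax_leqP => i _; apply/bigmax_leqP => k _.
rewrite leqn0 absz_eq0.
have /colP/(_ i) : A *m (y - z) = 0 by rewrite mulmxBr Ayz subrr.
have all_j (k' : 'I_n) : k' = j.
  by apply/val_inj => /=; have := ltn_ord k'; have := ltn_ord j; lia.
rewrite !mxE (bigD1 j) //= big1 ?addr0; last by move=> k'; rewrite (all_j k') eqxx.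
by move/eqP; rewrite !mxE mulf_eq0 (negPf d0) orbF (all_j k).
Qed.

Theorem theorem16 (R : realType) :
  exists C : R, 0 < C /\
    forall (m n : nat) (A : 'M[int]_(m, n)) (b : 'cV[int]_m) (Delta : nat),
      Delta = max_abs_entry A ->
      (1 < m * Delta)%N ->
      let V := vertices (@integer_hull R m n A b) in
      finite_set V /\
      (#|` fset_set V|)%:R <=
        (n%:R * m%:R * log2 (m%:R * Delta%:R))
          `^ (C * (m%:R * log2 (Num.sqrt m%:R * Delta%:R))) :> R.
Proof.
(* X <= B ^ 6 and 5 m t <= 20 m lam below, whence 120. *)
exists 120; split => // m n A b Delta DeltaE mD V.
have m0 : (0 < m)%N by case: (m) mD.
have D0 : (0 < Delta)%N by case: (Delta) mD => //; rewrite muln0.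
have n0 : (0 < n)%N.
  case: n A b V DeltaE => // A b V DeltaE; move: D0; rewrite DeltaE.
  by rewrite /max_abs_entry big1 // => i _; rewrite big_ord0.
have m1R : 1 <= m%:R :> R by rewrite ler1n.
have D1R : 1 <= Delta%:R :> R by rewrite ler1n.
have n1R : 1 <= n%:R :> R by rewrite ler1n.
have ln2 : 0 < ln 2 :> R by apply: ln_gt0; rewrite ltr1n.
set l := log2 (m%:R * Delta%:R); set lam := log2 _.
have log2_le (x y : R) : 0 < x -> x <= y -> log2 x <= log2 y.
  move=> x0 xy; rewrite ler_pM2r ?invr_gt0 // ler_ln // posrE //.
  exact: lt_le_trans xy.
have log2_exp k : log2 (2 ^+ k) = k%:R :> R.
  by rewrite /log2 lnXn // -[ln 2 *+ _]mulr_natl mulfK // gt_eqF.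
have l1 : 1 <= l.
  rewrite -[1]/(1%:R) -log2_exp expr1; apply: log2_le => //.
  by rewrite -natrM ler_nat.
(* Here [2 * lam] is the logarithm of [m * Delta ^ 2]. *)
have l_lam : l <= 2 * lam.
  have -> : 2 * lam = log2 ((Num.sqrt m%:R * Delta%:R) ^+ 2).
    by rewrite /log2 lnXn ?mulr_gt0 ?sqrtr_gt0 ?ltr0n // mulrA mulr_natl.
  apply: log2_le; first by rewrite -natrM ltr0n muln_gt0 m0.
  by rewrite exprMn sqr_sqrtr // ler_wpM2l // expr2 ler_peMr.
set B := n%:R * m%:R * l.
have nm1 : 1 <= n%:R * m%:R :> R by rewrite -natrM ler1n muln_gt0 n0.
have nB : n%:R <= B by rewrite /B -mulrA ler_peMr // mulr_ege1.
have B1 : 1 <= B by apply: le_trans nB.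
(* For n = m = 1 and Delta = 2 the base B equals 1. *)
have [n1|n2] := leqP n 1.
  have [Vfin Vle] := @card_vertices_le1 R m n A b n1 ltac:(by rewrite -DeltaE -lt0n).
  split => //; apply: (@le_trans _ _ (B `^ 0)); first by rewrite powRr0 lern1.
  apply: ler_powR => //; apply: mulr_ge0 => //; apply: mulr_ge0 => //; lra.
have B2 : 2 <= B by apply: le_trans nB; rewrite ler_nat.
pose t := up_log 2 (m * Delta).
have t0 : (0 < t)%N by rewrite up_log_gt0.
have tl : t%:R <= 2 * l.
  (* Minimality of [t] gives [2 ^ (t - 1) < m * Delta]; then [t <= l + 1 <= 2 * l]. *)
  suff : t.-1%:R <= l by rewrite -{2}(prednK t0) -natr1; lra.
  rewrite -log2_exp; apply: log2_le; first by rewrite exprn_gt0.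
  by rewrite -natrX -natrM ler_nat ltnW // up_log_gtn.
have [|Vfin Vle] := @card_vertices_le R m n A b t m0 n0 t0.
  by rewrite -DeltaE; apply: up_logP.
split => //; move: Vle; set X := (n * _)%N; set s := (5 * m * t)%N => Vle.
(* The chain is [X <= 6 * n * (n * m * t) <= 12 * B ^ 2 <= 2 ^ 4 * B ^ 2 <= B ^ 6], the last by
   [B >= 2]. *)
have XB : X%:R <= B ^+ 6.
  have : (X <= 6 * n * (n * m * t))%N by rewrite /X; nia.
  rewrite -(ler_nat R) !natrM => XB; apply: (le_trans XB).
  have nmt : n%:R * m%:R * t%:R <= 2 * B by rewrite /B; nra.
  have h1 : n%:R * (n%:R * m%:R * t%:R) <= B * (2 * B).
    by apply: ler_pM => //; rewrite -!natrM ler0n.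
  have h2 : 2 ^+ 4 <= B ^+ 4 by apply: lerXn2r => //; rewrite nnegrE //; lra.
  have h3 : 0 <= B ^+ 2 by rewrite exprn_ge0 //; lra.
  rewrite (exprD B 4 2); nra.
apply: (@le_trans _ _ ((B ^+ 6) ^+ s)).
  apply: (@le_trans _ _ (X ^ s)%:R); first by rewrite ler_nat.
  by rewrite natrX; apply: lerXn2r => //; rewrite nnegrE // exprn_ge0 //; lra.
rewrite -exprM -powR_mulrn; last by lra.
apply: ler_powR => //; rewrite /s !natrM.
have : m%:R * t%:R <= m%:R * (4 * lam) by rewrite ler_wpM2l //; lra.
lra.
Qed.
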